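(* Let $\Gamma\subset X$ be a non-recurrent set, closed in the standard topology of $\mathbb{R}^n$, and let $\Lambda_0\subset\mathbb{C}$ be an arbitrary set of complex numbers such that at least one element of $\Lambda_0$ has a non-zero real part and $\Lambda_0=\overline{\Lambda_0}$ (i.e. $\Lambda_0$ is closed under complex conjugation). Set $\Lambda=\mathrm{lattice}(\Lambda_0)$ and let $G=\{g_i\}_{i=1}^\infty$ denote an arbitrary set of functions in $\mathcal{C}(\Gamma)$ whose span is dense in $\mathcal{C}(\Gamma)$ in the supremum norm. Then the span of $$\Phi_{\Lambda,G}=\{\phi_{\lambda,g}\mid\lambda\in\Lambda,\ g\in G\}$$ is dense in $\mathcal{C}(X_T)$, i.e., for every $h\in\mathcal{C}(X_T)$ and any $\epsilon>0$ there exist $\phi_1,\ldots,\phi_N\in\Phi_{\Lambda,G}$ and complex numbers $c_1,\ldots,c_N$ such that $$\sup_{x\in X_T}\Big|h(x)-\sum_{i=1}^N c_i\phi_i(x)\Big|<\epsilon.$$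
   Context: Let $X\subset\mathbb{R}^n$ and let $f$ be a Lipschitz continuous vector field on $X$. Consider the dynamical system $\dot x=f(x)$ with state $x\in X$. Its flow is denoted by $S_t(x)$, i.e. $\frac{d}{dt}S_t(x)=f(S_t(x))$, $S_0(x)=x$, and it is assumed to be well defined for all $x\in X$ and all $t\ge 0$; for $t<0$, $S_t(x)$ denotes the backward flow where it exists. $\mathcal{C}(Y)$ denotes the space of continuous complex-valued functions on a set $Y\subset\mathbb{R}^n$; spans are over $\mathbb{C}$. Fix $T\in(0,\infty)$. A set $\Gamma\subset X$ is called non-recurrent if $x\in\Gamma$ implies $S_t(x)\notin\Gamma$ for all $t\in(0,T]$. Set $X_T=\bigcup_{t\in[0,T]}S_t(\Gamma)=\bigcup_{t\in[0,T]}\{S_t(x_0)\mid x_0\in\Gamma\}$. For $x\in X_T$, $\tau(x)\in[-T,0]$ denotes the (unique, by non-recurrence) time $t\in[-T,0]$ such that $S_t(x)\in\Gamma$. For $\lambda\in\mathbb{C}$ and $g\in\mathcal{C}(\Gamma)$ define $\phi_{\lambda,g}:X_T\to\mathbb{C}$ by $$\phi_{\lambda,g}(x)=e^{-\lambda\tau(x)}\,g(S_{\tau(x)}(x)),$$ equivalently $\phi_{\lambda,g}(S_t(x_0))=e^{\lambda t}g(x_0)$ for all $x_0\in\Gamma$, $t\in[0,T]$. For a set $\Lambda_0\subset\mathbb{C}$, $$\mathrm{lattice}(\Lambda_0)=\Big\{\sum_{k=1}^p\alpha_k\lambda_k\ \Big|\ \lambda_k\in\Lambda_0,\ \alpha_k\in\mathbb{N}_0,\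 p\in\mathbb{N}\Big\},$$ where $\mathbb{N}=\{1,2,\ldots\}$ and $\mathbb{N}_0=\mathbb{N}\cup\{0\}$. *)

(* Defs.v *)
From HB Require Import structures.
From mathcomp Require Import all_boot all_order all_algebra.
From mathcomp Require Import all_classical all_reals all_analysis.
From mathcomp Require Import complex.

Set Implicit Arguments.
Unset Strict Implicit.
Unset Printing Implicit Defensive.

Import Order.TTheory GRing.Theory Num.Theory.
Import numFieldNormedType.Exports.

Local Open Scope classical_set_scope.
Local Open Scope complex_scope.
Local Open Scope ring_scope.

(* R[i] repackaged as an abstract numClosedFieldType: the norm topology of
   MathComp-Analysis is found on (the sort of) such a structure, but not on the
   bare type [complex R]. *)
Definition Cplx (R : realType) : numClosedFieldType := R[i].

Definition cexp (R : realType) (z : Cplx R) : Cplx R :=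
  (expR (complex.Re z) * cos (complex.Im z)) +i*
  (expR (complex.Re z) * sin (complex.Im z)).

(* Elements of C(Y) are represented by total functions h with
   {within Y, continuous h}; their values outside Y are irrelevant. *)
Section FunctionsOnSets.
Context {R : realType} {V : topologicalType}.
Implicit Types (Y : set V) (F : set (V -> Cplx R)) (h k : V -> Cplx R).

Definition cspan F : set (V -> Cplx R) :=
  [set k | exists (N : nat) (c : 'I_N -> Cplx R) (p : 'I_N -> V -> Cplx R),
     (forall i, F (p i)) /\ k = (fun x => \sum_(i < N) c i * p i x)].

Definition sup_dist Y h k : \bar R :=
  ereal_sup [set (Normc.normc (h x - k x))%:E | x in Y].

Definition sup_dense Y F : Prop :=
  forall h, {within Y, continuous h} ->
  forall eps : R, 0 < eps -> exists2 k, F k & (sup_dist Y h k < eps%:E)%E.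

End FunctionsOnSets.

Definition lattice (R : realType) (L0 : set (Cplx R)) : set (Cplx R) :=
  [set z | exists (p : nat) (l : 'I_p -> Cplx R) (a : 'I_p -> nat),
     [/\ (0 < p)%N, (forall k, L0 (l k)) & z = \sum_(k < p) (a k)%:R * l k]].

Section Flow.
Context {R : realType} {n : nat}.
Notation V := 'rV[R]_n.
Implicit Types (X Gam : set V) (f : V -> V) (S : R -> V -> V) (T : R).

(* The derivative is relative to the time interval J, hence one-sided at the
   endpoints of J. *)
Definition solves X f (J : set R) (u : R -> V) : Prop :=
  forall t, J t ->
    X (u t) /\ (s - t)^-1 *: (u s - u t) @[s --> within J t^'] --> f (u t).

Definition backward_flow_exists X f (t : R) (x : V) : Prop :=
  exists2 u, solves X f `[t, 0] u & u 0 = x.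

(* S t x is unspecified when t < 0 and the backward flow does not exist. *)
Definition is_flow X f S : Prop :=
  forall x, X x ->
    [/\ S 0 x = x,
        solves X f `[0, +oo[ (fun t => S t x) &
        forall t u, t < 0 -> solves X f `[t, 0] u -> u 0 = x -> S t x = u t].

Definition non_recurrent S T Gam : Prop :=
  forall x, Gam x -> forall t, 0 < t <= T -> ~ Gam (S t x).

Definition XT S T Gam : set V := \bigcup_(t in `[0, T]) (S t @` Gam).

(* [get] picks the time t, which exists and is unique for x in X_T when Gam is
   non-recurrent. Existence of the backward flow has to be required since S t x
   is otherwise an arbitrary value. *)
Definition tau X f S T Gam (x : V) : R :=
  get [set t : R | [/\ - T <= t <= 0, backward_flow_exists X f t x
                     & Gam (S t x)]].

Definition phi X f S T Gam (lam : Cplx R) (g : V -> Cplx R) : V -> Cplx R :=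
  fun x => let t := tau X f S T Gam x in cexp (- lam * t%:C) * g (S t x).

Definition Phi X f S T Gam (L : set (Cplx R)) (G : set (V -> Cplx R)) :
    set (V -> Cplx R) :=
  [set phi X f S T Gam lam g | lam in L & g in G].

End Flow.

(* Main.v *)
Require Import Defs.
From HB Require Import structures.
From mathcomp Require Import all_boot all_order all_algebra.
From mathcomp Require Import all_classical all_reals all_analysis.
From mathcomp Require Import complex.
From mathcomp Require Import ring lra.

Set Implicit Arguments.
Unset Strict Implicit.
Unset Printing Implicit Defensive.

Import Order.TTheory GRing.Theory Num.Theory.
Import numFieldNormedType.Exports.

Local Open Scope classical_set_scope.
Local Open Scope ring_scope.

(** Transported along the flow, a function h on X_T becomes the function
    (t, x) |-> h (S_t x) on [0, T] x Gam, and phi_(lam, g) becomes the product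
    e^(lam t) g(x) ([tau_flow]).  So the theorem is a density statement for
    products of exponentials in t and functions on Gam.

    If lam in L0 has non-zero real part, then a = lam + conj lam is real and
    non-zero, and all its multiples a j lie in the lattice ([lattice_real]).
    The exponentials e^(a j t) are the powers of s = e^(a t), so every
    polynomial in s may be used as time factor ([cspan_poly]).  In the affine
    coordinate y = (s - 1) / (e^(a T) - 1), which maps [0, T] bijectively to
    [0, 1] ([exp_reparam]), the Bernstein polynomials of (y, x) |-> h (S_t x)
    are sums of products of a polynomial in s and a function h (S_(t_k) x),
    k = 0, ..., N.  They converge uniformly in (t, x), because h (S_t x) is
    bounded and equicontinuous in t ([bernstein_approx],
    [flow_equicontinuous]); each h o S_(t_k) is then replaced by an element of
    the span of the g_i that is close to it on Gam.  The weights of the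
    Bernstein polynomials are non-negative with sum 1, so these errors do not
    accumulate.

    Two points need an argument.  Equicontinuity rests on compactness of
    [0, T] x Gam, while Gam is only assumed to be closed.  But density of the
    span of a sequence in the supremum norm forces Gam to be bounded: on an
    unbounded set a diagonal construction gives a continuous function that
    outgrows every finite linear combination of the g_i
    ([sup_dense_bounded]).  And tau (S_t x) = - t requires that solutions are
    unique in both time directions, which comes from a two-sided Gronwall
    inequality for the squared Euclidean distance of two solutions
    ([gronwall], [solves_gap]); the same inequality makes S_t Lipschitz on X,
    uniformly for t in [0, T]. *)

(** * The sum of squares and the norm on row vectors *)

Lemma coord_le_norm (R : realType) (n : nat) (x : 'rV[R]_n) (i : 'I_n) :
  `|x ord0 i| <= `|x|.
Proof.
rewrite [leRHS]/Num.norm /= mx_normrE.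
by apply/bigmax_geP; right => /=; exists (ord0, i).
Qed.

Lemma norm_le_coord (R : realType) (n : nat) (x : 'rV[R]_n) (c : R) :
  0 <= c -> (forall i, `|x ord0 i| <= c) -> `|x| <= c.
Proof.
move=> c0 xc; rewrite /Num.norm /= mx_normrE.
by apply/bigmax_leP; split => // -[i j] _ /=; rewrite (ord1 i).
Qed.

(** The norm of ['rV_n] is the maximum norm, which need not be
    differentiable along a solution; the squared Euclidean norm is, and it is
    equivalent. *)
Definition sqsum (R : realType) (n : nat) (x : 'rV[R]_n) : R :=
  \sum_(i < n) x ord0 i ^+ 2.

Lemma sqr_norm_le_sqsum (R : realType) (n : nat) (x : 'rV[R]_n) :
  `|x| ^+ 2 <= sqsum x.
Proof.
have s0 : 0 <= sqsum x by apply: sumr_ge0 => i _; exact: sqr_ge0.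
rewrite -(sqr_sqrtr s0) lerXn2r ?nnegrE ?sqrtr_ge0//.
apply: norm_le_coord => [|i]; first exact: sqrtr_ge0.
rewrite -sqrtr_sqr ler_sqrt// /sqsum (bigD1 i)//= lerDl.
by apply: sumr_ge0 => j _; exact: sqr_ge0.
Qed.

Lemma sqsum_le_sqr_norm (R : realType) (n : nat) (x : 'rV[R]_n) :
  sqsum x <= n%:R * `|x| ^+ 2.
Proof.
apply: (@le_trans _ _ (\sum_(i < n) `|x| ^+ 2)).
  apply: ler_sum => i _; rewrite -real_normK ?num_real//.
  by rewrite lerXn2r ?nnegrE//; exact: coord_le_norm.
by rewrite sumr_const card_ord mulr_natl.
Qed.

(** * Solutions of the differential equation *)

(** The error-bound form of the derivative does not divide by s - t, so it
    survives restriction and translation of the time interval and passes to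
    coordinates without treating s = t apart. *)
Lemma solvesP (R : realType) (n : nat) (X : set 'rV[R]_n)
    (f : 'rV[R]_n -> 'rV[R]_n) (J : set R) (u : R -> 'rV[R]_n) :
  solves X f J u <->
  (forall t, J t -> X (u t) /\ forall e : R, 0 < e -> exists2 d : R, 0 < d &
     forall s, J s -> `|s - t| < d ->
       `|u s - u t - (s - t) *: f (u t)| <= e * `|s - t|).
Proof.
have key t s (e : R) : s != t ->
    (`|f (u t) - (s - t)^-1 *: (u s - u t)| <= e) =
    (`|u s - u t - (s - t) *: f (u t)| <= e * `|s - t|).
  move=> st; have st0 : s - t != 0 by rewrite subr_eq0.
  have -> : f (u t) - (s - t)^-1 *: (u s - u t) =
      - ((s - t)^-1 *: (u s - u t - (s - t) *: f (u t))).
    by rewrite [in RHS]scalerBr scalerA mulVf// scale1r opprB.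
  by rewrite normrN normrZ normfV mulrC ler_pdivrMr// normr_gt0.
split=> [H t Jt | H t Jt]; have [Xt D] := H _ Jt; split => //.
  move=> e e0; have /cvgrPdist_le/(_ _ e0) := D.
  rewrite near_withinE /dnbhs near_withinE => /nbhs_ballP[d /= d0 dP].
  exists d => // s Js sd; have [->|st] := eqVneq s t.
    by rewrite !subrr normr0 mulr0 scale0r subr0 normr0.
  rewrite -key//; apply: dP => //=.
  by rewrite /ball /= distrC.
apply/cvgrPdist_le => e e0; have [d d0 dP] := D _ e0.
rewrite near_withinE /dnbhs near_withinE; apply/nbhs_ballP; exists d => //= s.
by rewrite /ball /= distrC => sd st Js; rewrite key//; exact: dP.
Qed.

Lemma solves_sub (R : realType) (n : nat) (X : set 'rV[R]_n)
    (f : 'rV[R]_n -> 'rV[R]_n) (J J' : set R) (u : R -> 'rV[R]_n) :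
  J' `<=` J -> solves X f J u -> solves X f J' u.
Proof.
move=> sJ /solvesP H; apply/solvesP => t /sJ Jt; have [Xt D] := H _ Jt.
split=> // e e0; have [d d0 dP] := D _ e0; exists d => // s /sJ Js; exact: dP.
Qed.

Lemma solves_shift (R : realType) (n : nat) (X : set 'rV[R]_n)
    (f : 'rV[R]_n -> 'rV[R]_n) (J J' : set R) (c : R) (u : R -> 'rV[R]_n) :
  (forall t, J' t -> J (c + t)) -> solves X f J u ->
  solves X f J' (fun t => u (c + t)).
Proof.
move=> sJ /solvesP H; apply/solvesP => t /sJ Jt; have [Xt D] := H _ Jt.
split=> // e e0; have [d d0 dP] := D _ e0; exists d => // s /sJ Js sd.
have E : c + s - (c + t) = s - t by ring.
by have := dP _ Js; rewrite E; apply.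
Qed.

(** Under the bound on dw, the function e^(- K t) w(t) is nonincreasing and
    e^(K t) w(t) is nondecreasing; the first gives the estimate forwards in time,
    the second backwards. *)
Lemma gronwall (R : realType) (a b K : R) (w dw : R -> R) :
  {within `[a, b], continuous w} ->
  (forall t, t \in `]a, b[%R -> is_derive t 1 w (dw t)) ->
  (forall t, t \in `]a, b[%R -> `|dw t| <= K * w t) ->
  forall s t, s \in `[a, b]%R -> t \in `[a, b]%R ->
    w t <= expR (K * `|t - s|) * w s.
Proof.
move=> cw Dw dwK.
pose E (c : R) := (fun t : R => expR (c * t)).
have dE c (t : R) : is_derive t 1 (E c) (c * expR (c * t)).
  have dl : is_derive t 1 (fun r : R => c * r) c.
    have := is_deriveM (is_derive_cst c t 1) (is_derive_id t 1).
    by move=> D; apply: (is_derive_eq D); rewrite /GRing.scale/= mulr1 mulr0 addr0.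
  by rewrite mulrC; exact: is_derive1_comp.
have dEw c (t : R) : t \in `]a, b[%R ->
    is_derive t 1 (fun t => E c t * w t) (expR (c * t) * (dw t + c * w t)).
  move=> tab; have d1 := dE c t; have d2 := Dw _ tab.
  apply: (is_derive_eq (is_deriveM d1 d2)).
  by rewrite /GRing.scale/= /E; ring.
have cEw c : {within `[a, b], continuous (fun t => E c t * w t)}.
  move=> t; apply: (@continuousM _ _ (E c : subspace _ -> R) w).
    apply: continuous_subspaceT => {}t.
    by apply/differentiable_continuous/derivable1_diffP; case: (dE c t).
  exact: cw.
have dd c t : t \in `]a, b[%R -> derivable (fun t => E c t * w t) t 1.
  by move=> tab; case: (dEw c t tab).
have dec := @ler0_derive1_le_cc _ (fun t => E (- K) t * w t) a b
  (dd (- K)) _ (cEw (- K)).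
have inc := @ger0_derive1_le_cc _ (fun t => E K t * w t) a b
  (dd K) _ (cEw K).
move=> s t sab tab; case: (leP s t) => st.
  have -> : expR (K * `|t - s|) = expR (K * t) * expR (- (K * s)).
    by rewrite ger0_norm ?subr_ge0// -expRD; congr expR; ring.
  have dle0 r : r \in `]a, b[%R -> (fun t => E (- K) t * w t)^`()%classic r <= 0.
    move=> rab; rewrite derive1E (@derive_val _ _ _ _ _ _ _ (dEw _ _ rab)).
    rewrite mulr_ge0_le0 ?expR_ge0//.
    by have := dwK _ rab; rewrite ler_norml => /andP[_]; lra.
  have := dec dle0 t s tab sab st.
  by rewrite /E /= !mulNr !expRN ler_pdivrMl ?expR_gt0// mulrA.
have -> : expR (K * `|t - s|) = (expR (K * t))^-1 * expR (K * s).
  rewrite ltr0_norm ?subr_lt0// -expRN -expRD; congr expR; ring.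
rewrite -mulrA ler_pdivlMl ?expR_gt0//.
apply: inc => //; last exact: ltW.
move => r rab; rewrite derive1E (@derive_val _ _ _ _ _ _ _ (dEw _ _ rab)).
rewrite mulr_ge0 ?expR_ge0//; have := dwK _ rab; rewrite ler_norml => /andP[+ _].
lra.
Qed.

(** * Continuity on a subset in terms of distances *)

Lemma within_continuousP (R : realType) (V W : normedModType R) (Y : set V)
    (h : V -> W) :
  {within Y, continuous h} <->
  (forall x, Y x -> forall e : R, 0 < e -> exists2 d : R, 0 < d &
     forall y, Y y -> `|y - x| < d -> `|h y - h x| <= e).
Proof.
split=> [/subspace_continuousP H x Yx e e0|H].
  have /cvgrPdist_le/(_ _ e0) := H x Yx.
  rewrite near_withinE => /nbhs_ballP[d /= d0 dP].
  exists d => // y Yy yd; rewrite distrC; apply: dP => //.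
  by rewrite -ball_normE /ball_ /= distrC.
apply/subspace_continuousP => x Yx; apply/cvgrPdist_le => e e0.
have [d d0 dP] := H _ Yx _ e0.
rewrite near_withinE; apply/nbhs_ballP; exists d => //= y.
by rewrite -ball_normE /ball_ /= distrC => yd Yy; rewrite distrC; exact: dP.
Qed.

Lemma Cplx_normE (R : realType) (z : Cplx R) : `|z| = (Normc.normc z)%:C%C.
Proof. by case: z. Qed.

(** The norm of [Cplx R] takes its values in [Cplx R] itself, so this case has to
    be reduced to real bounds separately. *)
Lemma Cplx_within_continuousP (R : realType) (V : normedModType R) (Y : set V)
    (h : V -> Cplx R) :
  {within Y, continuous h} <->
  (forall x, Y x -> forall e : R, 0 < e -> exists2 d : R, 0 < d &
     forall y, Y y -> `|y - x| < d -> Normc.normc (h y - h x) <= e).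
Proof.
split=> [/subspace_continuousP H x Yx e e0|H].
  have e0' : 0 < e%:C%C :> Cplx R by rewrite ltcR.
  have /cvgrPdist_le/(_ _ e0') := H x Yx.
  rewrite near_withinE => /nbhs_ballP[d /= d0 dP].
  exists d => // y Yy yd; rewrite -lecR -Cplx_normE distrC; apply: dP => //.
  by rewrite -ball_normE /ball_ /= distrC.
apply/subspace_continuousP => x Yx; apply/cvgrPdist_le => e e0.
have er : (complex.Re e)%:C%C = e by apply: RRe_real; exact: gtr0_real.
have e0' : 0 < complex.Re e by rewrite -ltcR er.
have [d d0 dP] := H _ Yx _ e0'.
rewrite near_withinE; apply/nbhs_ballP; exists d => //= y.
rewrite -ball_normE /ball_ /= distrC => yd Yy; rewrite distrC.
by rewrite Cplx_normE -er lecR; exact: dP.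
Qed.

(** * Two-sided dependence of solutions on their values *)

Section Solutions.
Context {R : realType} {n : nat}.
Implicit Types (X : set 'rV[R]_n) (f : 'rV[R]_n -> 'rV[R]_n).

Lemma solves_continuous X f (J : set R) (u : R -> 'rV[R]_n) :
  solves X f J u -> {within J, continuous u}.
Proof.
move=> /solvesP H; apply/within_continuousP => t Jt e e0.
have [_ /(_ 1 ltr01)[d d0 dP]] := H _ Jt.
pose c := 1 + `|f (u t)|; have c0 : 0 < c by rewrite ltr_wpDr.
exists (Num.min d (e / c)); first by rewrite lt_min d0 divr_gt0.
move=> s Js; rewrite lt_min => /andP[sd se].
have := dP _ Js sd; rewrite mul1r => h1.
rewrite -(subrK ((s - t) *: f (u t)) (u s - u t)).
apply: (le_trans (ler_normD _ _)); rewrite normrZ.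
apply: (@le_trans _ _ (`|s - t| * c)).
  by rewrite /c mulrDr mulr1 lerD2r.
by rewrite -ler_pdivlMr// ltW.
Qed.

Lemma solves_coord_continuous X f (J : set R) (u : R -> 'rV[R]_n) i :
  solves X f J u -> {within J, continuous (fun t => u t ord0 i)}.
Proof.
move=> /solves_continuous/within_continuousP H.
apply/within_continuousP => t Jt e e0; have [d d0 dP] := H _ Jt _ e0.
exists d => // s Js sd; apply: le_trans (dP _ Js sd).
by apply: le_trans (coord_le_norm _ i); rewrite !mxE.
Qed.

Lemma solves_coord_derive X f (a b : R) (u : R -> 'rV[R]_n) i t :
  solves X f `[a, b] u -> t \in `]a, b[%R ->
  is_derive t 1 (fun t => u t ord0 i) (f (u t) ord0 i).
Proof.
move=> /solvesP H tab.
have abt : `[a, b]%classic t by rewrite /= in_itv /= !ltW ?(itvP tab).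
have [_ D] := H _ abt.
have L : (fun h : R => h^-1 *: (u (h *: 1 + t) ord0 i - u t ord0 i)) @ 0^'
    --> f (u t) ord0 i.
  apply/cvgrPdist_le => e e0; have [d d0 dP] := D _ e0.
  rewrite /dnbhs near_withinE; apply/nbhs_ballP.
  exists (Num.min d (Num.min (t - a) (b - t))).
    by rewrite /= !lt_min d0 !subr_gt0 !(itvP tab).
  move=> h; rewrite -ball_normE /ball_ /= sub0r normrN !lt_min.
  move=> /andP[hd /andP[ha hb]] h0.
  have Js : `[a, b]%classic (h + t).
    move: ha hb; rewrite !ltr_norml => /andP[ha _] /andP[_ hb].
    by rewrite /= in_itv /=; apply/andP; split; lra.
  have := dP _ Js; rewrite addrK => /(_ hd) le1.
  rewrite -[_ *: 1]/(h * 1) mulr1.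
  have -> : f (u t) ord0 i - h^-1 *: (u (h + t) ord0 i - u t ord0 i) =
      - (h^-1 * (u (h + t) - u t - h *: f (u t)) ord0 i).
    by rewrite !mxE -[_ *: _]/(_ * _); field.
  rewrite normrN normrM normfV mulrC ler_pdivrMr ?normr_gt0//.
  exact: le_trans (coord_le_norm _ _) le1.
split; first by apply/cvg_ex; exists (f (u t) ord0 i).
exact: cvg_lim L.
Qed.

(** For w = sum_i (u_i - v_i)^2, each of the n terms of w' is at most
    2 L |u - v|^2 in absolute value, and |u - v|^2 <= w. *)
Lemma solves_sqsum_gap X f (L a b : R) (u v : R -> 'rV[R]_n) :
  0 <= L -> (forall x y, X x -> X y -> `|f x - f y| <= L * `|x - y|) ->
  solves X f `[a, b] u -> solves X f `[a, b] v ->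
  forall s t, s \in `[a, b]%R -> t \in `[a, b]%R ->
  sqsum (u t - v t) <=
    expR (2 * n%:R * L * `|t - s|) * sqsum (u s - v s).
Proof.
move=> L0 fL su sv s t sab tab.
pose D i := fun t : R => u t ord0 i - v t ord0 i.
have DE r : sqsum (u r - v r) = (\sum_(i < n) (D i ^+ 2)) r.
  by rewrite fct_sumE; apply: eq_bigr => i _; rewrite /D !mxE.
rewrite !DE.
pose dD i r := (2 * D i r ^+ 1) *: (f (u r) ord0 i - f (v r) ord0 i).
apply: (@gronwall _ a b (2 * n%:R * L) _ (fun r => \sum_(i < n) dD i r)) => //.
- elim/big_ind: _ => [|F G cF cG|i _]; first by move=> r; exact: cvg_cst.
    by move=> r; apply: continuousD; [exact: cF|exact: cG].
  have cD : {within `[a, b], continuous D i}.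
    have cu := solves_coord_continuous (i := i) su.
    have cv := solves_coord_continuous (i := i) sv.
    by move=> r; apply: continuousB; [exact: cu|exact: cv].
  by rewrite expr2 => r; apply: continuousM; exact: cD.
- move=> r rab; apply: is_derive_sum => i; apply: is_deriveX.
  have du := solves_coord_derive i su rab; have dv := solves_coord_derive i sv rab.
  exact: is_deriveB du dv.
move=> r rab.
have rab' : `[a, b]%classic r by rewrite /= in_itv /= !ltW ?(itvP rab).
have := DE r; move=> <-.
have [[Xu _] [Xv _]] := (su _ rab', sv _ rab').
apply: (le_trans (ler_norm_sum _ _ _)).
apply: (@le_trans _ _ (\sum_(i < n) 2 * L * `|u r - v r| ^+ 2)).
  apply: ler_sum => i _; rewrite /dD /GRing.scale/= expr1 !normrM.
  have h1 : `|D i r| <= `|u r - v r|.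
    by apply: le_trans (coord_le_norm _ i); rewrite !mxE.
  have h2 : `|f (u r) ord0 i - f (v r) ord0 i| <= L * `|u r - v r|.
    by apply: le_trans (fL _ _ Xu Xv); apply: le_trans (coord_le_norm _ i); rewrite !mxE.
  rewrite (ger0_norm (ler0n _ 2)) expr2 -!mulrA ler_pM2l// mulrCA.
  exact: ler_pM.
rewrite sumr_const card_ord -[leLHS]mulr_natr.
rewrite [leLHS](_ : _ = 2 * n%:R * L * `|u r - v r| ^+ 2); last by ring.
by rewrite ler_wpM2l ?sqr_norm_le_sqsum// !mulr_ge0.
Qed.

Lemma solves_gap X f (L a b : R) (u v : R -> 'rV[R]_n) :
  0 <= L -> (forall x y, X x -> X y -> `|f x - f y| <= L * `|x - y|) ->
  solves X f `[a, b] u -> solves X f `[a, b] v ->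
  forall s t, s \in `[a, b]%R -> t \in `[a, b]%R ->
  `|u t - v t| ^+ 2 <=
    expR (2 * n%:R * L * `|t - s|) * n%:R * `|u s - v s| ^+ 2.
Proof.
move=> L0 fL su sv s t sab tab; apply: (le_trans (sqr_norm_le_sqsum _)).
apply: (le_trans (solves_sqsum_gap L0 fL su sv sab tab)).
by rewrite -[leRHS]mulrA ler_pM2l ?expR_gt0//; exact: sqsum_le_sqr_norm.
Qed.

Lemma solves_unique X f (L a b : R) (u v : R -> 'rV[R]_n) (s t : R) :
  0 <= L -> (forall x y, X x -> X y -> `|f x - f y| <= L * `|x - y|) ->
  solves X f `[a, b] u -> solves X f `[a, b] v ->
  s \in `[a, b]%R -> t \in `[a, b]%R -> u s = v s -> u t = v t.
Proof.
move=> L0 fL su sv sab tab us.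
have := solves_gap L0 fL su sv sab tab.
rewrite us subrr normr0 expr0n mulr0 => h.
by apply/eqP; rewrite -subr_eq0 -normr_eq0 -sqrf_eq0 eq_le h sqr_ge0.
Qed.
End Solutions.

(** * The flow and the return time *)

Section FlowFacts.
Context {R : realType} {n : nat} {X : set 'rV[R]_n} {f : 'rV[R]_n -> 'rV[R]_n}
  {S : R -> 'rV[R]_n -> 'rV[R]_n} {L T : R} {Gam : set 'rV[R]_n}.
Context (L_ge0 : 0 <= L)
  (fL : forall x y, X x -> X y -> `|f x - f y| <= L * `|x - y|)
  (S_flow : is_flow X f S) (Gam_sub : Gam `<=` X)
  (Gam_nonrec : non_recurrent S T Gam).

Lemma flow_solves (b : R) x : X x -> solves X f `[0, b] (fun t => S t x).
Proof.
move=> /S_flow[_ + _]; apply: solves_sub => t /=.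
by rewrite !in_itv /= => /andP[->].
Qed.

(** [solves_gap] bounds squares of norms, whence the square root; the summand 1
    only keeps C positive in dimension 0. *)
Lemma flow_lipschitz : exists2 C : R, 0 < C & forall x y t,
  X x -> X y -> 0 <= t <= T -> `|S t x - S t y| <= C * `|x - y|.
Proof.
pose C2 := expR (2 * n%:R * L * T) * n%:R.
have C20 : 0 <= C2 by rewrite mulr_ge0 ?expR_ge0.
exists (Num.sqrt C2 + 1) => [|x y t Xx Xy /andP[t0 tT]].
  by rewrite ltr_wpDl ?sqrtr_ge0.
apply: (@le_trans _ _ (Num.sqrt C2 * `|x - y|)); last first.
  by rewrite ler_wpM2r// lerDl.
rewrite -(@ler_pXn2r _ 2) ?nnegrE ?mulr_ge0 ?sqrtr_ge0// exprMn sqr_sqrtr//.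
have [[x0 _ _] [y0 _ _]] := (S_flow Xx, S_flow Xy).
have := @solves_gap _ _ _ _ _ 0 t _ _ L_ge0 fL (flow_solves Xx) (flow_solves Xy) 0 t.
rewrite x0 y0 subr0 !in_itv/= !lexx t0 (ger0_norm t0) => /(_ isT isT) /le_trans; apply.
by rewrite ler_wpM2r ?sqr_ge0// ler_wpM2r// ler_expR ler_wpM2l// !mulr_ge0.
Qed.

Lemma flow_continuous_time x t (e : R) : X x -> 0 <= t -> 0 < e ->
  exists2 d : R, 0 < d & forall s, 0 <= s -> `|s - t| < d -> `|S s x - S t x| <= e.
Proof.
move=> Xx t0 e0; have [_ /solves_continuous/within_continuousP H _] := S_flow Xx.
have [|d d0 dP] := H t _ _ e0; first by rewrite /= in_itv /= t0.
by exists d => // s s0 sd; apply: dP; rewrite //= in_itv /= s0.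
Qed.

Lemma flow_past_solves x t : X x -> 0 <= t ->
  solves X f `[- t, 0] (fun s => S (t + s) x).
Proof.
move=> Xx t0; apply: solves_shift (flow_solves (b := t) Xx) => s /=.
by rewrite !in_itv /= => /andP[? ?]; apply/andP; split; lra.
Qed.

(** The orbit of x, read backwards from S_t x, is the solution that identifies
    S_(- t). *)
Lemma flow_backward x t : X x -> 0 <= t ->
  backward_flow_exists X f (- t) (S t x) /\ S (- t) (S t x) = x.
Proof.
move=> Xx; rewrite le_eqVlt => /predU1P[<-|t0].
  have [S0 _ _] := S_flow Xx; rewrite !oppr0 !S0; split=> //.
  exists (fun s => S s x) => //; exact: flow_solves.
have H := flow_past_solves Xx (ltW t0); have E : S (t + 0) x = S t x by rewrite addr0.
split; first by exists (fun s => S (t + s) x).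
have XSt : X (S t x).
  have [_ /(_ t)] := S_flow Xx; rewrite /= in_itv /= (ltW t0) => /(_ isT)[//].
have [_ _ /(_ _ _ _ H E)] := S_flow XSt.
rewrite oppr_lt0 t0 => /(_ isT) ->; rewrite subrr.
by have [] := S_flow Xx.
Qed.

(** A competing time t' comes with a backward solution u from S_t x to a point
    u t' of Gam.  By uniqueness u runs along the orbit of x as long as that orbit
    is known, i.e. down to time - t.  If t' lies beyond - t, the orbit of u t'
    meets x in Gam at time - t' - t; otherwise the orbit of x meets u t' in Gam
    at time t + t'.  Non-recurrence leaves only t' = - t. *)
Lemma tau_flow x t : Gam x -> 0 <= t <= T -> tau X f S T Gam (S t x) = - t.
Proof.
move=> Gx /andP[t0 tT]; have Xx := Gam_sub Gx.
have [bt St] := flow_backward Xx t0.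
apply: get_unique => [|t' [/andP[t'T t'0] [u su u0] Gu]].
  by split; [rewrite lerNl opprK lerNl oppr0 tT t0|exact: bt|rewrite St].
have Ey : S t' (S t x) = u t'.
  have XSt : X (S t x).
    have [_ /(_ t)] := S_flow Xx; rewrite /= in_itv /= t0 => /(_ isT)[//].
  have [S0 _ SB] := S_flow XSt.
  move: t'0; rewrite le_eqVlt => /predU1P[t'0|t'0]; last exact: SB su u0.
  by rewrite t'0 S0 u0.
rewrite Ey in Gu; have Xy := Gam_sub Gu.
have sw := flow_past_solves Xx t0.
have [S0x _ _] := S_flow Xx; have [S0y _ _] := S_flow Xy.
case: (leP t (- t')) => tr.
  have t'E : `[- t, 0] `<=` `[t', 0].
    by move=> s /=; rewrite !in_itv /= => /andP[? ->]; rewrite andbT; lra.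
  have e1 : u (- t) = x.
    have := solves_unique L_ge0 fL (solves_sub t'E su) sw (s := 0) (t := - t).
    rewrite u0 addr0 subrr S0x; apply=> //.
      by rewrite in_itv /= lexx oppr_le0 t0.
    by rewrite in_itv /= lexx oppr_le0 t0.
  have sv : solves X f `[0, - t'] (fun s => u (t' + s)).
    apply: solves_shift su => s /=; rewrite !in_itv /= => /andP[? ?].
    by apply/andP; split; lra.
  have e2 : S (- t' - t) (u t') = x.
    have := solves_unique L_ge0 fL (flow_solves Xy) sv (s := 0) (t := - t' - t).
    have -> : t' + (- t' - t) = - t by ring.
    rewrite addr0 S0y e1; apply => //; rewrite in_itv /=.
      by rewrite lexx lerNr oppr0.
    by rewrite subr_ge0 tr lerBlDr lerDl.
  apply/eqP; rewrite eq_le lerNr tr /= leNgt; apply/negP => lt.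
  apply: (Gam_nonrec Gu (t := - t' - t)); last by rewrite e2.
  by apply/andP; split; lra.
have t'E : `[t', 0] `<=` `[- t, 0].
  by move=> s /=; rewrite !in_itv /= => /andP[? ->]; rewrite andbT; lra.
have e1 : u t' = S (t + t') x.
  apply: (solves_unique L_ge0 fL su (solves_sub t'E sw) (s := 0)).
  - by rewrite in_itv /= lexx t'0.
  - by rewrite in_itv /= lexx t'0.
  - by rewrite addr0.
exfalso; apply: (Gam_nonrec Gx (t := t + t')); last by rewrite -e1.
by apply/andP; split; lra.
Qed.

End FlowFacts.

(** * The real-valued norm of complex numbers *)

Section ComplexNorm.
Context {R : realType}.
Implicit Types z : Cplx R.
Local Notation N := (@Normc.normc R).

Lemma cnorm_ge0 z : 0 <= N z.
Proof. by rewrite -lecR -Cplx_normE normr_ge0. Qed.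

Lemma cnormM z1 z2 : N (z1 * z2) = N z1 * N z2.
Proof. exact: Normc.normcM. Qed.

Lemma cnorm_sum I (r : seq I) (P : pred I) (F : I -> Cplx R) :
  N (\sum_(i <- r | P i) F i) <= \sum_(i <- r | P i) N (F i).
Proof.
rewrite -lecR -Cplx_normE; apply: (le_trans (ler_norm_sum _ _ _)).
rewrite (eq_bigr (fun i => (N (F i))%:C%C)); last by move=> i _; exact: Cplx_normE.
by rewrite -(rmorph_sum (@real_complex R)).
Qed.

Lemma cnormB z1 z2 : N (z1 - z2) = N (z2 - z1).
Proof. by apply: (@complexI R); rewrite -!Cplx_normE distrC. Qed.

Lemma cnorm_dist z1 z2 z3 : N (z1 - z3) <= N (z1 - z2) + N (z2 - z3).
Proof.
rewrite -lecR rmorphD /= -!Cplx_normE; exact: ler_distD.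
Qed.

Lemma cnorm_ge_sub z1 z2 : N z1 - N z2 <= N (z1 - z2).
Proof.
rewrite -lecR rmorphB /= -!Cplx_normE; exact: lerB_dist.
Qed.

Lemma cnorm_real (x : R) : N (x%:C%C) = `|x|.
Proof. by rewrite /= expr0n addr0 sqrtr_sqr. Qed.

End ComplexNorm.

Lemma sup_dist_le (R : realType) (V : topologicalType) (Y : set V)
    (h k : V -> Cplx R) (e : R) :
  (sup_dist Y h k <= e%:E)%E <-> (forall x, Y x -> Normc.normc (h x - k x) <= e).
Proof.
split=> [H x Yx|H].
  by rewrite -lee_fin; apply: le_trans H; apply: ereal_sup_ubound; exists x.
by apply: ge_ereal_sup => _ [x Yx <-]; rewrite lee_fin; exact: H.
Qed.

(** * Sup-dense spans of sequences live on bounded sets *)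

(** The function is A r = sum_i max(0, r - i) b_i: near each r only finitely many
    terms are non-zero, and for r >= k + 1 the k-th term alone is at least b_k.
    Local Lipschitz continuity lets A |x| be continuous in x. *)
Lemma exists_real_fun_ge (R : realType) (b : nat -> R) : (forall i, 0 <= b i) ->
  exists A : R -> R, [/\ (forall r, 0 <= A r),
    (forall k r, k.+1%:R <= r -> b k <= A r) &
    (forall M : R, exists2 B : R, 0 < B & forall r s, r < M -> s < M ->
       `|A r - A s| <= B * `|r - s|)].
Proof.
move=> b0; pose c (r : R) i := Num.max 0 (r - i%:R) * b i.
have c0 r i : 0 <= c r i by rewrite mulr_ge0// le_max lexx.
pose P m r := \sum_(i < m) c r i.
have PE m m' r : (m <= m')%N -> r <= m%:R -> P m r = P m' r.
  move=> mm' rm; rewrite /P -!(big_mkord xpredT) (big_cat_nat (leq0n m) mm')/=.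
  rewrite [X in _ = _ + X]big_nat_cond [X in _ = _ + X]big1 ?addr0// => i /andP[/andP[mi _] _].
  rewrite /c max_l ?mul0r// subr_le0; apply: (le_trans rm); by rewrite ler_nat.
pose m (r : R) := (Num.truncn r).+1; have mP r : r <= (m r)%:R by rewrite ltW// truncnS_gt.
exists (fun r => P (m r) r); split=> [r|k r kr|M].
- by apply: sumr_ge0.
- have -> : P (m r) r = P (maxn (m r) k.+1) r by apply: PE => //; exact: leq_maxl.
  have km : (k < maxn (m r) k.+1)%N by exact: leq_maxr.
  rewrite /P (bigD1 (Ordinal km))//=; apply: ler_wpDr; first exact: sumr_ge0.
  rewrite /c -[leLHS]mul1r ler_wpM2r// le_max; apply/orP; right.
  by rewrite lerBrDr addrC natr1.
exists (\sum_(i < m M) b i + 1) => [|r s rM sM].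
  by rewrite ltr_wpDl// sumr_ge0.
have E q : q < M -> P (m q) q = P (m M) q.
  move=> qM; rewrite (PE _ (maxn (m q) (m M)))//; last exact: leq_maxl.
  rewrite -(PE (m M))//; first exact: leq_maxr.
  exact: le_trans (ltW qM) (mP M).
rewrite !E// /P -sumrB; apply: (le_trans (ler_norm_sum _ _ _)).
rewrite mulrDl mul1r mulr_suml; apply: ler_wpDr => //.
apply: ler_sum => i _; rewrite /c -mulrBl normrM mulrC (ger0_norm (b0 _)).
rewrite ler_wpM2l//.
have h x y : x <= y -> Num.max 0 (y - i%:R) - Num.max 0 (x - i%:R) <= y - x :> R.
  by move=> xy; rewrite /Num.max; case: ltP => ?; case: ltP => ?; lra.
have h' x y : x <= y -> Num.max 0 (x - i%:R) <= Num.max 0 (y - i%:R) :> R.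
  by move=> xy; rewrite /Num.max; case: ltP => ?; case: ltP => ?; lra.
case: (leP r s) => rs.
  by rewrite !ler0_norm ?subr_le0 ?h'// !opprB h.
by rewrite !ger0_norm ?subr_ge0 ?h' ?h ?ltW.
Qed.

(** Diagonal argument: on an unbounded set pick points x_k with |x_k| > k + 1 and
    a continuous h with h (x_k) >= k (1 + sum_(i <= k) |g_i (x_k)|).  A combination
    of the g_i whose indices, and whose coefficients' absolute sum, are at most K
    is then at distance at least K from h at x_K. *)
Lemma sup_dense_bounded (R : realType) (V : normedModType R) (Y : set V)
    (g : nat -> V -> Cplx R) :
  sup_dense Y (cspan (range g)) -> bounded_set Y.
Proof.
move=> gd; apply: contrapT => nb.
have /choice[x xP] : forall k : nat, exists x, Y x /\ k.+1%:R < `|x|.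
  move=> k; apply: contrapT => H; apply: nb.
  exists k.+1%:R; split; first exact: num_real.
  move=> M kM y Yy; apply: le_trans (ltW kM).
  by rewrite leNgt; apply/negP => yk; apply: H; exists y.
pose s k := \sum_(i < k.+1) Normc.normc (g i (x k)).
have s0 k : 0 <= s k by apply: sumr_ge0 => i _; exact: cnorm_ge0.
pose b k := k%:R * (1 + s k).
have b0 k : 0 <= b k by rewrite mulr_ge0// addr_ge0.
have [A [A0 Ab AL]] := exists_real_fun_ge b0.
pose h (y : V) : Cplx R := (A `|y|)%:C%C.
have ch : {within Y, continuous h}.
  apply/Cplx_within_continuousP => y _ e e0.
  have [B B0 BP] := AL (`|y| + 1).
  exists (Num.min 1 (e / B)); first by rewrite lt_min ltr01 divr_gt0.
  move=> z _; rewrite lt_min => /andP[z1 ze].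
  have nz := ler_dist_dist z y.
  rewrite /h -rmorphB cnorm_real; apply: (le_trans (BP _ _ _ _)).
  - by have := ler_normD (z - y) y; rewrite subrK; lra.
  - by rewrite ltrDl.
  rewrite mulrC -ler_pdivlMr//; exact: le_trans nz (ltW ze).
have [k [N [c [p [pg ->]]]] /ltW/sup_dist_le hk] := gd h ch 1 ltr01.
have /choice[j jP] : forall i, exists j, g j = p i.
  by move=> i; have [j _ <-] := pg i; exists j.
pose C := \sum_(i < N) Normc.normc (c i).
(* K >= 2 makes the gap exceed the bound 1 chosen above. *)
pose K := maxn 2 (maxn (\max_(i < N) j i) (Num.truncn C).+1).
have CK : C <= K%:R.
  apply: (le_trans (ltW (truncnS_gt C))).
  by rewrite ler_nat /K !leq_max leqnn !orbT.
have K2 : 2%:R <= K%:R :> R by rewrite ler_nat leq_maxl.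
have jK i : (j i <= K)%N.
  by rewrite /K !leq_max leq_bigmax orbT.
have [YxK xK] := xP K.
have := hk _ YxK; apply/negP; rewrite -ltNge.
apply: lt_le_trans (cnorm_ge_sub _ _).
have : Normc.normc (\sum_(i < N) c i * p i (x K)) <= C * s K.
  apply: (le_trans (cnorm_sum _ _ _)); rewrite mulr_suml.
  apply: ler_sum => i _; rewrite cnormM ler_wpM2l ?cnorm_ge0// -jP /s.
  have jK' : (j i < K.+1)%N by rewrite ltnS.
  rewrite (bigD1 (Ordinal jK'))//= lerDl; apply: sumr_ge0 => ? _; exact: cnorm_ge0.
have : Normc.normc (h (x K)) >= K%:R * (1 + s K).
  rewrite cnorm_real ger0_norm//; exact: Ab (ltW xK).
have := s0 K; have : C * s K <= K%:R * s K by rewrite ler_wpM2r.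
move: K2; nra.
Qed.

(** * Bernstein approximation *)

Section Bernstein.
Context {R : realType}.

Definition bernstein (N k : nat) : {poly R} :=
  'C(N, k)%:R *: ('X^k * (1 - 'X) ^+ (N - k)).

Lemma bernsteinE N k y :
  (bernstein N k).[y] = 'C(N, k)%:R * (y ^+ k * (1 - y) ^+ (N - k)).
Proof. by rewrite /bernstein !hornerE. Qed.

Lemma bernstein_ge0 N k y : 0 <= y <= 1 -> 0 <= (bernstein N k).[y].
Proof.
move=> /andP[y0 y1]; rewrite bernsteinE mulr_ge0// mulr_ge0// exprn_ge0//.
by rewrite subr_ge0.
Qed.

(** One more Bernoulli trial: Pascal's rule splits the expectation of F at N + 1
    trials according to the outcome of the additional one. *)
Lemma bernstein_sumS (F : nat -> R) N y :
  \sum_(k < N.+2) F k * (bernstein N.+1 k).[y] =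
  (1 - y) * (\sum_(k < N.+1) F k * (bernstein N k).[y]) +
  y * (\sum_(k < N.+1) F k.+1 * (bernstein N k).[y]).
Proof.
rewrite big_ord_recl /= bernsteinE bin0 expr0 !mul1r subn0.
have -> : \sum_(i < N.+1) F (bump 0 i) * (bernstein N.+1 (bump 0 i)).[y] =
    \sum_(i < N.+1) F i.+1 * ('C(N, i.+1)%:R * (y ^+ i.+1 * (1 - y) ^+ (N - i))) +
    y * \sum_(i < N.+1) F i.+1 * (bernstein N i).[y].
  rewrite mulr_sumr -big_split /=; apply: eq_bigr => i _.
  by rewrite /bump /= add1n !bernsteinE binS natrD subSS exprS; ring.
rewrite addrA; congr (_ + _).
rewrite big_ord_recr /= bin_small// !(mul0r, mulr0) addr0.
rewrite big_ord_recl /= bernsteinE bin0 expr0 !mul1r subn0 mulrDr exprS.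
rewrite mulrCA; congr (_ + _); rewrite mulr_sumr; apply: eq_bigr => i _.
rewrite /bump /= add1n bernsteinE.
have -> : (N - i = (N - i.+1).+1)%N by rewrite -subSn// subSS.
by rewrite !exprS; ring.
Qed.

Lemma bernstein_sum1 N y : \sum_(k < N.+1) (bernstein N k).[y] = 1.
Proof.
rewrite -[RHS](expr1n _ N) -[in RHS](subrK y 1) exprDn; apply: eq_bigr => k _.
by rewrite bernsteinE mulr_natl mulrC.
Qed.

(** The second moment of the binomial distribution about c: squared bias plus
    variance.  Keeping c general makes the induction close, since a success of
    the additional trial replaces c by c - 1. *)
Lemma bernstein_moment2 N y c :
  \sum_(k < N.+1) (k%:R - c) ^+ 2 * (bernstein N k).[y] =
  (N%:R * y - c) ^+ 2 + N%:R * (y * (1 - y)).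
Proof.
elim: N c => [|N IH] c.
  by rewrite big_ord1 bernsteinE bin0 !expr0 !mulr1 !mul0r addr0.
rewrite (bernstein_sumS (fun k => (k%:R - c) ^+ 2)) IH.
rewrite (eq_bigr (fun k : 'I__ => (k%:R - (c - 1)) ^+ 2 * (bernstein N k).[y])).
  by rewrite IH -natr1; ring.
by move=> k _; rewrite -natr1; congr (_ ^+ 2 * _); ring.
Qed.

(** Chebyshev's estimate: points k / N closer than d to y contribute at most e,
    and for the others 1 <= (y - k / N)^2 / d^2, whose mean is at most
    1 / (d^2 N).  The bound depends on p only through e, d and M, which gives
    uniformity over families of functions. *)
Lemma bernstein_approx (p : R -> Cplx R) (M e d : R) (N : nat) (y : R) :
  0 < d -> (0 < N)%N ->
  (forall y, 0 <= y <= 1 -> Normc.normc (p y) <= M) ->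
  (forall y z, 0 <= y <= 1 -> 0 <= z <= 1 -> `|y - z| < d ->
     Normc.normc (p y - p z) <= e) ->
  0 <= y <= 1 ->
  Normc.normc (p y - \sum_(k < N.+1) ((bernstein N k).[y])%:C%C * p (k%:R / N%:R))
    <= e + 2 * M / d ^+ 2 / N%:R.
Proof.
move=> d0 N0 pM pe y01.
have M0 : 0 <= M by apply: le_trans (pM _ y01); exact: cnorm_ge0.
have e0 : 0 <= e.
  by apply: le_trans (pe _ _ y01 y01 _); rewrite ?cnorm_ge0// subrr normr0.
have N0' : 0 < N%:R :> R by rewrite ltr0n.
have -> : p y = \sum_(k < N.+1) ((bernstein N k).[y])%:C%C * p y.
  by rewrite -mulr_suml -(rmorph_sum (@real_complex R)) bernstein_sum1 mul1r.
rewrite -sumrB; apply: (le_trans (cnorm_sum _ _ _)).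
pose c := 2 * M / d ^+ 2.
have c0 : 0 <= c by rewrite !mulr_ge0// invr_ge0 exprn_ge0// ltW.
apply: (@le_trans _ _ (\sum_(k < N.+1)
    (e * (bernstein N k).[y] + c / N%:R ^+ 2 * ((k%:R - N%:R * y) ^+ 2 * (bernstein N k).[y])))).
  apply: ler_sum => k _; rewrite -mulrBr cnormM cnorm_real.
  rewrite ger0_norm ?bernstein_ge0// mulrA -mulrDl mulrC ler_wpM2r ?bernstein_ge0//.
  have k01 : 0 <= (k%:R / N%:R : R) <= 1.
    by rewrite divr_ge0//= ler_pdivrMr// mul1r ler_nat -ltnS.
  (* A single weight e + c (y - k / N)^2 dominates both cases. *)
  have -> : c / N%:R ^+ 2 * (k%:R - N%:R * y) ^+ 2 = c * (y - k%:R / N%:R) ^+ 2.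
    by field; rewrite gt_eqF.
  case: (ltP `|y - k%:R / N%:R| d) => yk.
    by apply: ler_wpDr; [rewrite mulr_ge0// sqr_ge0|exact: pe].
  apply: ler_wpDl => //; apply: (@le_trans _ _ (2 * M)).
    have := cnorm_dist (p y) 0 (p (k%:R / N%:R)).
    rewrite subr0 (cnormB 0) subr0.
    by have := pM _ y01; have := pM _ k01; lra.
  rewrite /c mulrAC ler_pdivlMr ?exprn_gt0//.
  rewrite ler_wpM2l ?mulr_ge0// -[leRHS]real_normK ?num_real//.
  by rewrite lerXn2r ?nnegrE// ltW.
rewrite big_split /= -!mulr_sumr bernstein_sum1 bernstein_moment2 mulr1 lerD2l.
rewrite subrr expr0n add0r -/c.
have -> : c / N%:R ^+ 2 * (N%:R * (y * (1 - y))) = c / N%:R * (y * (1 - y)).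
  by field; rewrite gt_eqF.
have cN : 0 <= c / N%:R by apply: divr_ge0.
by rewrite -[leRHS]mulr1; apply: ler_wpM2l => //; case/andP: y01 => ? ?; nra.
Qed.

End Bernstein.

(** * The exponential time coordinate *)

(** The inverse of t |-> (e^(a t) - 1) / (e^(a T) - 1) is
    th y = ln (1 + y (e^(a T) - 1)) / a.  The argument of the logarithm is a convex
    combination of 1 and e^(a T), hence bounded below by the smaller of them, and
    ln is Lipschitz on such a half-line. *)
Lemma exp_reparam (R : realType) (a T : R) : a != 0 -> 0 < T ->
  let E := expR (a * T) - 1 in
  exists (th : R -> R) (C : R), [/\ 0 < C,
    forall t, 0 <= t <= T -> 0 <= (expR (a * t) - 1) / E <= 1 /\
       th ((expR (a * t) - 1) / E) = t,
    forall y, 0 <= y <= 1 -> 0 <= th y <= T &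
    forall y z, 0 <= y <= 1 -> 0 <= z <= 1 -> `|th y - th z| <= C * `|y - z|].
Proof.
move=> a0 T0 E; have E0 : E != 0.
  by rewrite subr_eq0 -expR0 (inj_eq (@expR_inj R)) mulf_neq0// gt_eqF.
pose m := Num.min 1 (expR (a * T)).
have m0 : 0 < m by rewrite lt_min ltr01 expR_gt0.
have um y : 0 <= y <= 1 -> m <= 1 + y * E.
  move=> /andP[y0 y1]; have m1 : m <= 1 by rewrite ge_min lexx.
  have mE : m <= 1 + E by rewrite /E addrC subrK ge_min lexx orbT.
  by nra.
exists (fun y => ln (1 + y * E) / a), (`|E| / `|a| / m); split.
- by rewrite !divr_gt0 ?normr_gt0.
- move=> t /andP[t0 tT]; split; last first.
    by rewrite divfK// addrC subrK expRK mulrC mulKf.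
  have [an|ap] := ltP a 0.
    have En : E < 0 by rewrite subr_lt0 -expR0 ltr_expR nmulr_rlt0.
    rewrite ler_ndivlMr// mul0r ler_ndivrMr// mul1r lerD2r ler_expR ler_nM2l// tT andbT.
    by rewrite subr_le0 -expR0 ler_expR nmulr_rle0.
  have {}ap : 0 < a by rewrite lt_neqAle eq_sym a0.
  have Ep : 0 < E by rewrite subr_gt0 -expR0 ltr_expR mulr_gt0.
  rewrite ler_pdivlMr// mul0r ler_pdivrMr// mul1r lerD2r ler_expR ler_pM2l// tT andbT.
  by rewrite subr_ge0 -expR0 ler_expR pmulr_rge0.
- move=> y y01; have u0 := lt_le_trans m0 (um _ y01); case/andP: y01 => y0 y1.
  have lnE : a * T = ln (1 + E) by rewrite /E addrC subrK expRK.
  have E1 : 0 < 1 + E by rewrite /E addrC subrK expR_gt0.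
  have [an|ap] := ltP a 0.
    have En : E < 0 by rewrite subr_lt0 -expR0 ltr_expR nmulr_rlt0.
    rewrite ler_ndivlMr// mul0r ler_ndivrMr// [T * a]mulrC lnE ler_ln ?posrE//.
    rewrite ln_le0; last by nra.
    by nra.
  have {}ap : 0 < a by rewrite lt_neqAle eq_sym a0.
  have Ep : 0 < E by rewrite subr_gt0 -expR0 ltr_expR mulr_gt0.
  rewrite ler_pdivlMr// mul0r ler_pdivrMr// [T * a]mulrC lnE ler_ln ?posrE//.
  rewrite ln_ge0; last by nra.
  by nra.
have lnB u v : m <= u -> m <= v -> ln u - ln v <= `|u - v| / m.
  move=> mu mv; have u0 := lt_le_trans m0 mu; have v0 := lt_le_trans m0 mv.
  rewrite -ln_div ?posrE//.
  have -> : u / v = 1 + (u - v) / v by field; rewrite gt_eqF.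
  apply: (@le_trans _ _ ((u - v) / v)).
    apply: le_ln1Dx; rewrite ltr_pdivlMr//; lra.
  apply: (@le_trans _ _ (`|u - v| / v)).
    by rewrite ler_pM2r ?invr_gt0// ler_norm.
  by rewrite ler_wpM2l// lef_pV2 ?posrE.
move=> y z y01 z01; rewrite -mulrBl normrM normfV.
have -> : `|E| / `|a| / m * `|y - z| = (`|y - z| * `|E|) / m / `|a| by ring.
rewrite ler_pM2r ?invr_gt0 ?normr_gt0// -normrM.
have e : (y - z) * E = (1 + y * E) - (1 + z * E) by ring.
rewrite e ler_norml lerNl opprB; apply/andP; split.
  by rewrite distrC; apply: lnB; exact: um.
by apply: lnB; exact: um.
Qed.

(** * Spans *)

Section Spans.
Context {R : realType} {V : topologicalType}.
Implicit Types (F : set (V -> Cplx R)) (k : V -> Cplx R).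

Lemma cspan0 F : cspan F (fun=> 0).
Proof.
exists 0%N, (fun=> 0), (fun=> fun=> 0); split; first by case.
by apply/funext => x; rewrite big_ord0.
Qed.

Lemma cspan_add F k1 k2 : cspan F k1 -> cspan F k2 ->
  cspan F (fun x => k1 x + k2 x).
Proof.
move=> [N1 [c1 [p1 [F1 ->]]]] [N2 [c2 [p2 [F2 ->]]]].
exists (N1 + N2)%N,
  (fun i => match fintype.split i with inl j => c1 j | inr j => c2 j end),
  (fun i => match fintype.split i with inl j => p1 j | inr j => p2 j end).
split; first by move=> i; case: (fintype.split i).
apply/funext => x; rewrite big_split_ord; congr (_ + _); apply: eq_bigr => i _.
  by rewrite -[lshift _ _]/(unsplit (inl i)) unsplitK.
by rewrite -[rshift _ _]/(unsplit (inr i)) unsplitK.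
Qed.

Lemma cspan_sum F (I : Type) (r : seq I) (k : I -> V -> Cplx R) :
  (forall i, cspan F (k i)) -> cspan F (fun x => \sum_(i <- r) k i x).
Proof.
move=> Fk; elim: r => [|i r IH].
  by under eq_fun do rewrite big_nil; exact: cspan0.
by under eq_fun do rewrite big_cons; exact: cspan_add.
Qed.

Lemma cspan_scale F c k : F k -> cspan F (fun x => c * k x).
Proof.
move=> Fk; exists 1%N, (fun=> c), (fun=> k); split => //.
by apply/funext => x; rewrite big_ord1.
Qed.

End Spans.

(** * Real multiples in the lattice and polynomials of exponentials *)

(** Taken with equal coefficients, lam and conj lam add up to a real number. *)
Lemma lattice_real (R : realType) (L0 : set (Cplx R)) (lam : Cplx R) (j : nat) :
  L0 = [set conjc lam | lam in L0] -> L0 lam ->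
  lattice L0 (2 * complex.Re lam * j%:R)%:C%C.
Proof.
move=> L0E L0l.
exists 2%N, (fun i : 'I_2 => if i == ord0 then lam else conjc lam), (fun=> j).
split=> // [k|].
  by case: ifP => // _; rewrite L0E; exists lam.
rewrite big_ord_recl big_ord1 /= -mulrDr.
case: lam {L0l} => a b /=; rewrite -(rmorph_nat (@real_complex R)).
by apply/eqP; rewrite eq_complex /=; apply/andP; split; apply/eqP; ring.
Qed.

Section Eigenfunctions.
Context {R : realType} {n : nat} {X : set 'rV[R]_n} {f : 'rV[R]_n -> 'rV[R]_n}
  {S : R -> 'rV[R]_n -> 'rV[R]_n} {T : R} {Gam : set 'rV[R]_n}.
Local Notation tau := (tau X f S T Gam).

Lemma cexp_real (r t : R) : cexp (- r%:C%C * t%:C%C : Cplx R) = (expR (- r * t))%:C%C.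
Proof.
rewrite -rmorphN -rmorphM /cexp /= cos0 sin0.
by rewrite mulr1 mulr0.
Qed.

Lemma phi_real (a : R) (j : nat) (g : 'rV[R]_n -> Cplx R) x :
  phi X f S T Gam (a * j%:R)%:C%C g x =
  (expR (- a * tau x) ^+ j)%:C%C * g (S (tau x) x).
Proof.
rewrite /phi cexp_real -expRM_natl; congr ((expR _)%:C%C * _).
by ring.
Qed.

(** The j-th power of e^(a t) is the time factor of the eigenfunction with
    eigenvalue a j, so expanding q and k gives a double sum of eigenfunctions.
    The identity holds at every point, also where tau is a default value. *)
Lemma cspan_poly (a : R) (Lam : set (Cplx R)) (F : set ('rV[R]_n -> Cplx R))
    (q : {poly R}) (k : 'rV[R]_n -> Cplx R) :
  (forall j : nat, Lam (a * j%:R)%:C%C) -> cspan F k ->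
  cspan (Phi X f S T Gam Lam F)
    (fun x => (q.[expR (- a * tau x)])%:C%C * k (S (tau x) x)).
Proof.
move=> Lama [N [c [p [Fp ->]]]].
have -> : (fun x => (q.[expR (- a * tau x)])%:C%C *
      \sum_(i < N) c i * p i (S (tau x) x)) =
    (fun x => \sum_(j < size q) \sum_(i < N)
      ((q`_j)%:C%C * c i) * phi X f S T Gam (a * j%:R)%:C%C (p i) x).
  apply/funext => x; rewrite horner_coef (rmorph_sum (@real_complex R)) mulr_suml.
  apply: eq_bigr => j _; rewrite mulr_sumr; apply: eq_bigr => i _.
  by rewrite phi_real rmorphM /=; ring.
apply: cspan_sum => j; apply: cspan_sum => i; apply: cspan_scale.
by exists (a * j%:R)%:C%C => //; exists (p i).
Qed.

End Eigenfunctions.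

(** * Uniform equicontinuity in time *)

Section Equicontinuity.
Context {R : realType} {V : normedModType R} {T : R} {Gam Y : set V}
  {S : R -> V -> V} {h : V -> Cplx R} {C : R}.
Context (C_gt0 : 0 < C) (Gam_compact : compact Gam)
  (S_Y : forall t x, 0 <= t <= T -> Gam x -> Y (S t x))
  (S_lip : forall x y t, Gam x -> Gam y -> 0 <= t <= T ->
     `|S t x - S t y| <= C * `|x - y|)
  (S_cont : forall x t (e : R), Gam x -> 0 <= t <= T -> 0 < e ->
     exists2 d : R, 0 < d & forall s, 0 <= s <= T -> `|s - t| < d ->
       `|S s x - S t x| <= e)
  (h_cont : {within Y, continuous h}).

Lemma flow_joint_continuous x t (e : R) : Gam x -> 0 <= t <= T -> 0 < e ->
  exists2 d : R, 0 < d & forall y s, Gam y -> 0 <= s <= T ->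
    `|y - x| < d -> `|s - t| < d -> Normc.normc (h (S s y) - h (S t x)) <= e.
Proof.
move=> Gx t0T e0.
have /Cplx_within_continuousP/(_ _ (S_Y t0T Gx) _ e0)[r r0 rP] := h_cont.
have r4 : 0 < r / 4 by rewrite divr_gt0.
have [d d0 dP] := S_cont Gx t0T r4.
exists (Num.min d (r / 4 / C)); first by rewrite lt_min d0 divr_gt0.
move=> y s Gy s0T; rewrite lt_min => /andP[_ yr]; rewrite lt_min => /andP[sd _].
apply: rP; first exact: S_Y.
apply: (@le_lt_trans _ _ (r / 4 + r / 4)); last by lra.
apply: (le_trans (ler_distD (S s x) _ _)); apply: lerD; last exact: dP.
by apply: (le_trans (S_lip Gy Gx s0T)); rewrite mulrC -ler_pdivlMr// ltW.
Qed.

(** Bound and modulus of continuity are obtained together from compactness of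
    [0, T] x Gam: near each point both hold for all small d, with d^-1 playing
    the role of the bound M. *)
Lemma flow_equicontinuous (e : R) : 0 < e ->
  exists d M : R, 0 < d /\ forall x s t, Gam x -> 0 <= s <= T -> 0 <= t <= T ->
    Normc.normc (h (S t x)) <= M /\
    (`|s - t| < d -> Normc.normc (h (S s x) - h (S t x)) <= e).
Proof.
move=> e0.
pose P (d : R) (tx : R * V) := Gam tx.2 -> 0 <= tx.1 <= T ->
  Normc.normc (h (S tx.1 tx.2)) <= d^-1 /\
  forall s, 0 <= s <= T -> `|s - tx.1| < d ->
    Normc.normc (h (S s tx.2) - h (S tx.1 tx.2)) <= e.
have K : compact (`[0, T] `*` Gam) by apply: compact_setX => //; exact: segment_compact.
have /compact_near_coveringP/(_ _ (0^'+) P) := K.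
have near_P tx : (`[0, T] `*` Gam) tx -> \forall x \near tx & d \near 0^'+, P d x.
  case: tx => t x [/=]; rewrite in_itv /= => t0T Gx.
  have e2 : 0 < Num.min 1 (e / 2) by rewrite lt_min ltr01 divr_gt0.
  have [r r0 rP] := flow_joint_continuous Gx t0T e2.
  pose M := Normc.normc (h (S t x)) + 1.
  have M0 : 0 < M by rewrite ltr_wpDl// cnorm_ge0.
  exists (ball (t, x) (r / 2), [set d | 0 < d < Num.min (r / 2) M^-1]).
    split; first by apply: nbhsx_ballx; rewrite divr_gt0.
    have m0 : 0 < Num.min (r / 2) M^-1 by rewrite lt_min invr_gt0 divr_gt0.
    near=> d; apply/andP; split; near: d; first exact: nbhs_right_gt.
    exact: nbhs_right_lt.
  move=> [[s y] d] /= [[]]; rewrite -!ball_normE /ball_ /= => st yx.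
  move=> /andP[d0]; rewrite lt_min => /andP[dr dM] Gy s0T /=.
  have yr : `|y - x| < r by rewrite distrC; lra.
  have sr : `|s - t| < r by rewrite distrC; lra.
  have := rP _ _ Gy s0T yr sr; rewrite le_min => /andP[n1 n2]; split.
    have : Normc.normc (h (S s y)) <= M.
      by have := cnorm_ge_sub (h (S s y)) (h (S t x)); rewrite /M; lra.
    move/le_trans; apply; rewrite -[leLHS]invrK lef_pV2 ?posrE ?invr_gt0//.
    exact: ltW.
  move=> s' s'0T s's.
  have s'r : `|s' - t| < r.
    apply: (le_lt_trans (ler_distD s _ _)).
    by move: st; rewrite (distrC t); lra.
  have := rP _ _ Gy s'0T yr s'r; rewrite le_min => /andP[_ n3].
  apply: (le_trans (cnorm_dist _ (h (S t x)) _)); rewrite (cnormB (h (S t x))).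
  by lra.
move=> /(_ _ near_P) H.
have [d [d0 dP]] : exists d : R, 0 < d /\ (`[0, T] `*` Gam) `<=` P d.
  have H2 : \forall d \near 0^'+, 0 < d /\ (`[0, T] `*` Gam) `<=` P d.
    by near=> d; split; near: d => //; exact: nbhs_right_gt.
  exact: filter_ex H2.
exists d, d^-1; split=> // x s t Gx s0T t0T.
have [|//|//|h1 h2] := dP (t, x) _; first by split; rewrite //= in_itv.
by split=> // st; exact: h2.
Unshelve. all: by end_near.
Qed.

End Equicontinuity.

(** * Density of the eigenfunctions *)

Theorem theorem2 (R : realType) (n : nat)
  (X : set 'rV[R]_n) (f : 'rV[R]_n -> 'rV[R]_n) (S : R -> 'rV[R]_n -> 'rV[R]_n)
  (f_lip : [lipschitz f x | x in X])
  (S_flow : is_flow X f S)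
  (T : R) (T_gt0 : 0 < T)
  (Gam : set 'rV[R]_n) (Gam_sub : Gam `<=` X)
  (Gam_nonrec : non_recurrent S T Gam) (Gam_closed : closed Gam)
  (L0 : set (Cplx R))
  (L0_Re : exists2 lam, L0 lam & complex.Re lam != 0)
  (L0_conj : L0 = [set conjc lam | lam in L0])
  (g : nat -> 'rV[R]_n -> Cplx R)
  (g_cont : forall i, {within Gam, continuous (g i)})
  (g_dense : sup_dense Gam (cspan (range g))) :
  sup_dense (XT S T Gam) (cspan (Phi X f S T Gam (lattice L0) (range g))).
Proof.
have [L L_ge0 fL] : exists2 L : R, 0 <= L &
    forall x y, X x -> X y -> `|f x - f y| <= L * `|x - y|.
  have [L [_ LP]] := f_lip.
  exists (Num.max 0 L + 1) => [|x y Xx Xy].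
    by rewrite addr_ge0// le_max lexx.
  apply: (LP _ _ (x, y)) => //=.
  by rewrite (@le_lt_trans _ _ (Num.max 0 L))// ?ltrDl// le_max lexx orbT.
have Gam_compact : compact Gam.
  by apply: bounded_closed_compact => //; exact: sup_dense_bounded g_dense.
have [C C_gt0 S_lip] := flow_lipschitz (T := T) L_ge0 fL S_flow.
have S_XT t x : 0 <= t <= T -> Gam x -> XT S T Gam (S t x).
  by move=> t0T Gx; exists t => //=; exists x.
move=> h h_cont eps eps_gt0.
pose e := eps / 4; have e_gt0 : 0 < e by rewrite divr_gt0.
have S_lipG x y t : Gam x -> Gam y -> 0 <= t <= T ->
    `|S t x - S t y| <= C * `|x - y|.
  by move=> Gx Gy; apply: S_lip; exact: Gam_sub.
have S_cont x t (r : R) : Gam x -> 0 <= t <= T -> 0 < r ->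
    exists2 d : R, 0 < d & forall s, 0 <= s <= T -> `|s - t| < d ->
      `|S s x - S t x| <= r.
  move=> Gx /andP[t0 _] r0.
  have [d d0 dP] := flow_continuous_time S_flow (Gam_sub _ Gx) t0 r0.
  by exists d => // s /andP[s0 _]; exact: dP.
have [d [M [d_gt0 dM]]] :=
  flow_equicontinuous C_gt0 Gam_compact S_XT S_lipG S_cont h_cont e_gt0.
have [lam L0lam Relam] := L0_Re.
pose a := 2 * complex.Re lam.
have a_neq0 : a != 0 by rewrite mulf_neq0.
have [th [D [D_gt0 yP th0T th_lip]]] := exp_reparam a_neq0 T_gt0.
set E := expR (a * T) - 1 in yP.
(* Times closer than d come from coordinates y closer than dy. *)
pose dy := d / D; have dy_gt0 : 0 < dy by rewrite divr_gt0.
pose N := (Num.truncn (2 * M / dy ^+ 2 / e)).+1.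
have N_large : 2 * M / dy ^+ 2 / N%:R <= e.
  rewrite ler_pdivrMr ?ltr0n// [e * _]mulrC -ler_pdivrMr//.
  by apply: ltW; exact: truncnS_gt.
have k01 (k : 'I_N.+1) : 0 <= (k%:R / N%:R : R) <= 1.
  by rewrite divr_ge0//= ler_pdivrMr ?ltr0n// mul1r ler_nat -ltnS.
have /choice[G GP] : forall k : 'I_N.+1, exists G, cspan (range g) G /\
    forall x, Gam x -> Normc.normc (h (S (th (k%:R / N%:R)) x) - G x) <= e.
  move=> k; set t := th _.
  have t0T : 0 <= t <= T by exact/th0T/k01.
  have ht : {within Gam, continuous (fun x => h (S t x))}.
    apply/Cplx_within_continuousP => x Gx r r0.
    have [q q0 qP] := flow_joint_continuous C_gt0 S_XT S_lipG S_cont h_cont Gx t0T r0.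
    by exists q => // y Gy yx; apply: qP => //; rewrite subrr normr0.
  have [G FG /ltW/sup_dist_le GP] := g_dense _ ht _ e_gt0.
  by exists G.
(* As a polynomial in s, the k-th Bernstein polynomial of y is its composition
   with E^-1 (s - 1). *)
exists (fun x => \sum_(k < N.+1)
  ((bernstein N k \Po (E^-1 *: ('X - 1))).[expR (- a * tau X f S T Gam x)])%:C%C
    * G k (S (tau X f S T Gam x) x)).
  apply: cspan_sum => k; apply: cspan_poly => [j|]; last by case: (GP k).
  exact: lattice_real.
apply: (@le_lt_trans _ _ (e + e + e)%:E); last by rewrite lte_fin /e; lra.
apply/sup_dist_le => _ [t t0T [x Gx <-]].
have {}t0T : 0 <= t <= T by move: t0T; rewrite /= in_itv.
rewrite (tau_flow L_ge0 fL S_flow Gam_sub Gam_nonrec Gx t0T).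
have [_ ->] := flow_backward S_flow (Gam_sub _ Gx) (proj1 (andP t0T)).
have [y01 thy] := yP _ t0T; set y := _ / E in y01 thy.
have hornery : (E^-1 *: ('X - 1)).[expR (- a * - t)] = y.
  by rewrite mulrNN !hornerE mulrC.
under eq_bigr => k _ do rewrite horner_comp hornery.
pose p z := h (S (th z) x).
have <- : p y = h (S t x) by rewrite /p thy.
apply: (le_trans (cnorm_dist _
  (\sum_(k < N.+1) ((bernstein N k).[y])%:C%C * p (k%:R / N%:R)) _)).
apply: lerD.
  apply: (@le_trans _ _ (e + 2 * M / dy ^+ 2 / N%:R)); last by rewrite lerD2l.
  apply: bernstein_approx => // [z z01|z z' z01 z'01 zz'].
    exact: (dM _ _ _ Gx (th0T _ z01) (th0T _ z01)).1.
  apply: (dM _ _ _ Gx (th0T _ z01) (th0T _ z'01)).2.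
  by apply: (le_lt_trans (th_lip _ _ z01 z'01)); rewrite mulrC -ltr_pdivlMr.
rewrite -sumrB; apply: (le_trans (cnorm_sum _ _ _)).
have -> : e = \sum_(k < N.+1) e * (bernstein N k).[y].
  by rewrite -mulr_sumr bernstein_sum1 mulr1.
apply: ler_sum => k _; rewrite -mulrBr cnormM cnorm_real.
rewrite ger0_norm ?bernstein_ge0// mulrC ler_wpM2r ?bernstein_ge0//.
exact: (GP k).2.
Qed.
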